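(* Let $T\ge2$ and let $\tau^{*,1}, \tau^{*,2}, \ldots, \tau^{*,T-1}\in[0,\infty)$ be asymptotically optimal for iteration $T$. Then for every $t<T$, $\tau^{*,1}, \ldots, \tau^{*,t-1}$ are asymptotically optimal for iteration $t$.
   Context: Fix $\delta\in(0,1)$, a noise variance $\sigma_\omega^2\ge0$, and a probability distribution $p_\beta$ on $\mathbb{R}$ with finite second moment. Let $B\sim p_\beta$ and $W\sim N(0,1)$ be independent, and let $\eta(a;\tau)=(|a|-\tau)_+\,\mathrm{sign}(a)$ be soft thresholding. The state evolution of approximate message passing (AMP) with thresholds $\tau^1,\tau^2,\ldots\ge0$ is $(\sigma^0)^2=\mathbb{E}[B^2]/\delta$ and $(\sigma^{t+1})^2=\sigma_\omega^2+\frac1\delta\mathbb{E}_{B,W}[(\eta(B+\sigma^tW;\tau^t)-B)^2]$; write $\sigma^T(\tau^1,\ldots,\tau^{T-1})$ for the resulting value at step $T$. (By the AMP state evolution theorem, $\sigma^t$ determines the almost-sure limit of the per-coordinate MSE of the AMP iterates in the asymptotic Gaussian-design setting.) A sequence $\tau^{*,1},\ldots,\tau^{*,T-1}$ is called asymptotically optimal for iteration $T$ if $\sigma^T(\tau^{*,1},\ldots,\tau^{*,T-1})\le\sigma^T(\tau^1,\ldots,\tau^{T-1})$ for all $(\tau^1,\ldots,\tau^{T-1})\in[0,\infty)^{T-1}$. (The paper assumes such minimizers exist, which excludes the case $p_\beta=\delta_0$.) *)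

(* Defs.v *)
From HB Require Import structures.
From mathcomp Require Import all_boot all_order all_algebra.
From mathcomp Require Import all_classical all_reals all_analysis.
Set Implicit Arguments. Unset Strict Implicit. Unset Printing Implicit Defensive.
Import Order.TTheory GRing.Theory Num.Theory.
Local Open Scope ring_scope.

Section AMP.
Context {R : realType}.

Definition soft_thresh (a tau : R) : R := Num.max (`|a| - tau) 0 * Num.sg a.

(* E_{B,W}[(eta(B + s W; tau) - B)^2], B ~ p, W ~ N(0,1) independent
   (expectation over the product law, written as an iterated integral). *)
Definition se_mse (p : probability R R) (s tau : R) : \bar R :=
  (\int[p]_b \int[normal_prob 0 1]_w
     ((soft_thresh (b + s * w) tau - b) ^+ 2)%:E)%E.

(* (sigma^t)^2 of the state evolution; tau t is the threshold tau^t used in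
   the step t -> t+1. *)
Fixpoint se_var (p : probability R R) (delta sw2 : R) (tau : nat -> R)
    (t : nat) : \bar R :=
  match t with
  | 0 => ((\int[p]_b (b ^+ 2)%:E) * (delta^-1)%:E)%E
  | t'.+1 => (sw2%:E + (delta^-1)%:E *
              se_mse p (Num.sqrt (fine (se_var p delta sw2 tau t'))) (tau t'))%E
  end.

Definition se_sigma (p : probability R R) (delta sw2 : R) (tau : nat -> R)
    (t : nat) : R := Num.sqrt (fine (se_var p delta sw2 tau t)).

(* taus^1, ..., taus^(T-1) are asymptotically optimal for iteration T
   (the initial threshold taus 0 = tau^0 is held fixed). *)
Definition asymp_optimal (p : probability R R) (delta sw2 : R) (T : nat)
    (taus : nat -> R) : Prop :=
  (forall k, (1 <= k < T)%N -> 0 <= taus k) /\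
  forall tau : nat -> R, tau 0%N = taus 0%N ->
    (forall k, (1 <= k < T)%N -> 0 <= tau k) ->
    se_sigma p delta sw2 taus T <= se_sigma p delta sw2 tau T.

End AMP.

(* Main.v *)
(* For a fixed ratio alpha = tau / s, the error eta(b + s w; alpha s) - b is the projection of -b
   onto the dilated interval s [w - alpha, w + alpha]; its modulus is nondecreasing in s for every
   b and w, and strictly increasing when w > alpha + |b| / s, an event of positive Gaussian
   probability. So a strictly smaller sigma^t allows, after rescaling tau^t proportionally, a
   strictly smaller sigma^{t+1}. An improvement at iteration t thus propagates to iteration T,
   against optimality at T. *)
Require Import Defs.
From HB Require Import structures.
From mathcomp Require Import all_boot all_order all_algebra.
From mathcomp Require Import all_classical all_reals all_analysis.
From mathcomp Require Import measurable_realfun ring lra.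
Import Order.TTheory GRing.Theory Num.Theory.
Local Open Scope ring_scope.
Local Open Scope classical_set_scope.

(** * Pointwise monotonicity of the thresholding error under dilation *)

Lemma soft_threshE {R : realType} (a tau : R) : 0 <= tau ->
  soft_thresh a tau = Num.max (a - tau) 0 - Num.max (- a - tau) 0.
Proof.
move=> tau0; rewrite /soft_thresh.
have [a0|a0|->] := ltgtP a 0.
- rewrite ltr0_norm// ltr0_sg// mulrN1.
  by rewrite (@max_r _ _ (a - tau)) ?sub0r//; lra.
- rewrite gtr0_norm// gtr0_sg// mulr1.
  by rewrite (@max_r _ _ (- a - tau)) ?subr0//; lra.
- by rewrite sgr0 mulr0 oppr0 sub0r subrr.
Qed.

Lemma soft_thresh_cases {R : realType} (a tau : R) : 0 <= tau ->
  [\/ 0 < a - tau /\ soft_thresh a tau = a - tau,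
      a + tau < 0 /\ soft_thresh a tau = a + tau |
      a - tau <= 0 <= a + tau /\ soft_thresh a tau = 0].
Proof.
move=> tau0; rewrite soft_threshE//.
have [h1|h1] := leP (a - tau) 0; have [h2|h2] := leP (- a - tau) 0.
- by apply: Or33; split; [apply/andP; split; lra|lra].
- by apply: Or32; split; lra.
- by apply: Or31; split; lra.
- by exfalso; lra.
Qed.

(** Since [y ^+ 2 - x ^+ 2 = (y - x) * (y + x)], comparing squares reduces to linear conditions,
    which [lra] can decide. *)
Lemma ler_sqr_same_sign {R : realType} (x y : R) :
  0 <= y - x /\ 0 <= y + x \/ y - x <= 0 /\ y + x <= 0 -> x ^+ 2 <= y ^+ 2.
Proof.
move=> h; rewrite -(subr_ge0 (x ^+ 2)) subr_sqr; move: h.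
by move=> [[? ?]|[? ?]]; [rewrite mulr_ge0|rewrite mulr_le0].
Qed.

Lemma se_error_le {R : realType} (alpha b w s s' : R) :
  0 <= alpha -> 0 <= s' <= s ->
  (soft_thresh (b + s' * w) (alpha * s') - b) ^+ 2 <=
  (soft_thresh (b + s * w) (alpha * s) - b) ^+ 2.
Proof.
move=> a0 /andP[s'0 ss'].
have s0 : 0 <= s by exact: le_trans ss'.
(* Applied to [w - alpha] and [w + alpha]: as the scale grows from [s'] to [s], each endpoint of the
   interval moves away from 0 without changing sign. *)
have scale x : (0 <= s' * x <= s * x) \/ (s * x <= s' * x <= 0).
  have [x0|/ltW x0] := leP 0 x; [left|right]; apply/andP; split.
  - exact: mulr_ge0.
  - exact: ler_wpM2r.
  - exact: ler_wnM2r.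
  - exact: mulr_ge0_le0.
have ea0 : 0 <= alpha * s' by rewrite mulr_ge0.
have eA0 : 0 <= alpha * s by rewrite mulr_ge0.
move: (scale (w - alpha)) (scale (w + alpha)).
rewrite !mulrBr !mulrDr ![_ * alpha]mulrC => hp hq.
apply: ler_sqr_same_sign.
have [] := soft_thresh_cases (b + s' * w) _ ea0;
have [] := soft_thresh_cases (b + s * w) _ eA0;
(* With the products generalized, every combination of regimes is a linear problem. *)
move: (alpha * s) (alpha * s') (s * w) (s' * w) ea0 eA0 hp hq => A A' S S' hA hA' hp hq.
all: move=> [h1 ->] [h2 ->]; case: hp => /andP[? ?]; case: hq => /andP[? ?].
all: try by exfalso; lra.
all: try by left; split; lra.
all: try by right; split; lra.
(* What remains is the case where both thresholded values vanish: both errors equal [- b], and the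
   sign of [b] selects the branch. *)
all: by have [b0|b0] := leP 0 b; [right|left]; split; lra.
Qed.

(** The condition on [w] puts [- b] to the left of the interval at scale [s], so the error there is
    [s * (w - alpha)], which exceeds both [|b|] and [s' * (w - alpha)]. The error at scale [s'] has
    modulus at most the larger of these two. *)
Lemma se_error_lt {R : realType} (alpha b w s s' : R) :
  0 <= alpha -> 0 <= s' < s -> alpha + `|b| / s < w ->
  (soft_thresh (b + s' * w) (alpha * s') - b) ^+ 2 <
  (soft_thresh (b + s * w) (alpha * s) - b) ^+ 2.
Proof.
move=> a0 /andP[s'0 ss'] hw.
have s0 : 0 < s by exact: le_lt_trans ss'.
have hb : `|b| < s * w - alpha * s.
  rewrite -[ltLHS](divfK (lt0r_neq0 s0)) [_ / _ * _]mulrC.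
  by rewrite [alpha * s]mulrC -mulrBr ltr_pM2l// ltrBrDl.
have aw : 0 < w - alpha by rewrite subr_gt0 (le_lt_trans _ hw)// lerDl divr_ge0// ltW.
have hp : s' * w - alpha * s' < s * w - alpha * s.
  by rewrite ![alpha * _]mulrC -!mulrBr ltr_pM2r.
have hp' : 0 <= s' * w - alpha * s'.
  by rewrite [alpha * _]mulrC -mulrBr mulr_ge0// ltW.
have ea0 : 0 <= alpha * s' by rewrite mulr_ge0.
have eA0 : 0 <= alpha * s by rewrite mulr_ge0// ltW.
have b1 := ler_norm b; have b2 := ler_norm (- b); rewrite normrN in b2.
have [] := soft_thresh_cases (b + s * w) _ eA0; move=> [h1 ->]; try by exfalso; lra.
rewrite -(subr_gt0 (_ ^+ 2)) subr_sqr.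
have [] := soft_thresh_cases (b + s' * w) _ ea0; move=> [h2 ->].
all: by apply: mulr_gt0; lra.
Qed.

(** * Strict inequalities between integrals *)

(** If the integral were 0, [f] would vanish almost everywhere, and [A] would lie in a null set. *)
Lemma integral_gt0 d (T : measurableType d) (R : realType) (mu : {measure set T -> \bar R})
    (D A : set T) (f : T -> \bar R) :
  measurable D -> measurable_fun D f -> (forall x, D x -> 0 <= f x)%E ->
  measurable A -> A `<=` D -> (0 < mu A)%E -> (forall x, A x -> 0 < f x)%E ->
  (0 < \int[mu]_(x in D) f x)%E.
Proof.
move=> mD mf f0 mA AD muA fA.
rewrite lt0e integral_ge0// andbT; apply/eqP => int0.
have : (\int[mu]_(x in D) `|f x| = 0)%E.
  by rewrite -int0; apply: eq_integral => x /[!inE] Dx; rewrite gee0_abs// f0.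
move/(ae_eq_integral_abs mu mD mf) => [N [mN muN subN]].
have : (mu A <= mu N)%E.
  apply: le_measure; rewrite ?inE// => x Ax; apply: subN => /= /(_ (AD _ Ax)) fx0.
  by have := fA _ Ax; rewrite fx0 ltxx.
by rewrite muN leNgt muA.
Qed.

(** Write [g] as [f + (g - f)]: the second summand has positive integral because of [A], and adding
    a positive amount to the finite integral of [f] increases it. *)
Lemma lt_integral d (T : measurableType d) (R : realType) (mu : {measure set T -> \bar R})
    (A : set T) (f g : T -> \bar R) :
  measurable_fun setT f -> measurable_fun setT g ->
  (forall x, 0 <= f x)%E -> (forall x, f x \is a fin_num) ->
  (forall x, f x <= g x)%E -> (\int[mu]_x f x < +oo)%E ->
  measurable A -> (0 < mu A)%E -> (forall x, A x -> f x < g x)%E ->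
  (\int[mu]_x f x < \int[mu]_x g x)%E.
Proof.
move=> mf mg f0 ffin fg intf mA muA fgA.
have -> : (\int[mu]_x g x = \int[mu]_x f x + \int[mu]_x (g x - f x))%E.
  rewrite -ge0_integralD//.
  - by apply: eq_integral => x _; rewrite addeC subeK.
  - by move=> x _; rewrite sube_ge0// ffin.
  - exact: emeasurable_funB.
rewrite lteDl; last by rewrite ge0_fin_numE// integral_ge0.
apply: (@integral_gt0 _ _ _ _ _ A) => //.
- exact: emeasurable_funB.
- by move=> x _; rewrite sube_ge0// ffin.
- by move=> x Ax; rewrite sube_gt0 fgA.
Qed.

(** * The Gaussian law: mass of rays, density, second moment *)

Lemma normal_pdf_gt0 {R : realType} (m s x : R) : s != 0 -> 0 < normal_pdf m s x.
Proof.
by move=> s0; rewrite normal_pdfE// mulr_gt0 ?normal_peak_gt0 ?expR_gt0.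
Qed.

Lemma normal_prob_ray_gt0 {R : realType} (c : R) :
  (0 < @normal_prob R 0 1 `]c, +oo[%classic)%E.
Proof.
rewrite /normal_prob.
apply: (@integral_gt0 _ _ _ (@lebesgue_measure R) `]c, +oo[%classic `]c, +oo[%classic
  (fun x => (normal_pdf 0 1 x)%:E)) => //.
- by apply: measurable_funTS; apply/measurable_EFinP; exact: measurable_normal_pdf.
- by move=> x _; rewrite lee_fin normal_pdf_ge0.
- have := @lebesgue_measure_itv R `]c, +oo[%R; rewrite /= ltry => muE.
  by rewrite [ltRHS]muE ltry.
- by move=> x _; rewrite lte_fin normal_pdf_gt0.
Qed.

(** The Radon-Nikodym derivative and [normal_pdf] have the same integral over every measurable set,
    so they agree almost everywhere. *)
Lemma ge0_integral_normal_prob {R : realType} (m s : R) (f : R -> \bar R) :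
  measurable_fun setT f -> (forall x, 0 <= f x)%E ->
  (\int[normal_prob m s]_x f x =
   \int[lebesgue_measure]_x (f x * (normal_pdf m s x)%:E))%E.
Proof.
move=> mf f0.
have dom := normal_prob_dominates m s.
rewrite -(Radon_Nikodym_SigmaFinite.change_of_variables dom)//.
apply: ae_eq_integral => //.
- by apply: emeasurable_funM => //; apply: (measurable_int lebesgue_measure);
    exact: Radon_Nikodym_SigmaFinite.f_integrable.
- apply: emeasurable_funM => //; apply/measurable_EFinP; exact: measurable_normal_pdf.
- apply: ae_eqe_mul2l => /=.
  apply: integral_ae_eq => //=.
  + exact: Radon_Nikodym_SigmaFinite.f_integrable.
  + by apply/measurable_EFinP; exact: measurable_normal_pdf.
  + by move=> E _ mE; rewrite -Radon_Nikodym_SigmaFinite.f_integral.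
Qed.

Lemma normal_prob_sqr_lty {R : realType} :
  (\int[@normal_prob R 0 1]_w (w ^+ 2)%:E < +oo)%E.
Proof.
rewrite ge0_integral_normal_prob; last 2 first.
- by apply/measurable_EFinP; exact: measurable_funX.
- by move=> x; rewrite lee_fin sqr_ge0.
(* w^2 exp(- w^2 / 2) <= 4 exp(- w^2 / 4): the moment is dominated by a multiple of N(0, 2) *)
pose c : R := 4 * normal_peak 1 / normal_peak (Num.sqrt 2).
have r2 : Num.sqrt 2 != 0 :> R by rewrite gt_eqF// sqrtr_gt0.
have c0 : 0 <= c.
  by rewrite /c divr_ge0 ?normal_peak_ge0// mulr_ge0 ?normal_peak_ge0.
apply: (@le_lt_trans _ _
   (\int[lebesgue_measure]_x (c%:E * (normal_pdf 0 (Num.sqrt 2) x)%:E))%E); last first.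
  rewrite ge0_integralZl//=; last 2 first.
  - by apply/measurable_EFinP; exact: measurable_normal_pdf.
  - by move=> x _; rewrite lee_fin normal_pdf_ge0.
  by rewrite integral_normal_pdf mule1 ltry.
apply: ge0_le_integral => //=.
- by move=> x _; rewrite -EFinM lee_fin mulr_ge0 ?sqr_ge0 ?normal_pdf_ge0.
- apply: emeasurable_funM; apply/measurable_EFinP; first exact: measurable_funX.
  exact: measurable_normal_pdf.
- by apply: measurable_funeM; apply/measurable_EFinP; exact: measurable_normal_pdf.
move=> x _; rewrite -!EFinM lee_fin !normal_pdfE ?oner_eq0//.
have -> : c * (normal_peak (Num.sqrt 2) * normal_fun 0 (Num.sqrt 2) x) =
    normal_peak 1 * (4 * normal_fun 0 (Num.sqrt 2) x).
  by rewrite /c; field; rewrite gt_eqF// normal_peak_gt0.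
rewrite mulrCA ler_wpM2l ?normal_peak_ge0//.
rewrite /normal_fun subr0 expr1n sqr_sqrtr//.
(* Half of the exponent absorbs the factor [x ^+ 2]: with [y = x ^+ 2 / 4], the bound
   [y <= 1 + y <= expR y] suffices. *)
have -> : - x ^+ 2 / (1 *+ 2) = - (x ^+ 2 / 4) + - (x ^+ 2 / 4) by field.
have -> : - x ^+ 2 / (2 *+ 2) = - (x ^+ 2 / 4) by field.
rewrite expRD mulrA ler_wpM2r ?expR_ge0//.
rewrite expRN ler_pdivrMr ?expR_gt0//.
by have := expR_ge1Dx (x ^+ 2 / 4); lra.
Qed.

(** * Measurability and a bound on the error uniform in the signal *)

Lemma measurable_se_error {R : realType} (s tau : R) : 0 <= tau ->
  measurable_fun setT (fun z : R * R =>
    ((soft_thresh (z.1 + s * z.2) tau - z.1) ^+ 2)%:E).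
Proof.
move=> tau0; apply/measurable_EFinP; apply: measurable_funX.
under eq_fun do rewrite soft_threshE//.
have m1 : measurable_fun setT (fun z : R * R => z.1) by exact: measurable_fst.
have m2 : measurable_fun setT (fun z : R * R => z.1 + s * z.2).
  by apply: measurable_funD => //; apply: measurable_funM => //; exact: measurable_snd.
apply: measurable_funB => //; apply: measurable_funB; apply: measurable_maxr => //.
- exact: measurable_funB.
- by apply: measurable_funB => //; exact: measurableT_comp.
Qed.

(** Soft thresholding moves its argument by at most [tau], so the error is at most [|s * w| + tau]
    in modulus, whatever [b] is. *)
Lemma se_error_ub {R : realType} (b w s tau : R) : 0 <= tau ->
  (soft_thresh (b + s * w) tau - b) ^+ 2 <= 2 * s ^+ 2 * w ^+ 2 + 2 * tau ^+ 2.
Proof.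
move=> tau0; rewrite -mulrA -exprMn.
have [] := soft_thresh_cases (b + s * w) _ tau0; move: (s * w) => x [h ->].
- by have := sqr_ge0 (x + tau); lra.
- by have := sqr_ge0 (x - tau); lra.
- move: h => /andP[h1 h2].
  (* Here [(b + x) ^+ 2 <= tau ^+ 2], and [2 * x ^+ 2 + 2 * (b + x) ^+ 2 - b ^+ 2] is the square of
     [b + 2 * x]. *)
  have : 0 <= (tau - (b + x)) * (tau + (b + x)) by rewrite mulr_ge0; lra.
  by have := sqr_ge0 (b + 2 * x); lra.
Qed.

(** * Risk at a fixed signal value, and its average over the signal *)

Section conditional_error.
Context {R : realType}.
Implicit Types s tau b : R.

Definition cond_mse s tau b : \bar R :=
  (\int[normal_prob 0 1]_w ((soft_thresh (b + s * w) tau - b) ^+ 2)%:E)%E.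

Lemma cond_mse_ge0 s tau b : (0 <= cond_mse s tau b)%E.
Proof. by apply: integral_ge0 => w _; rewrite lee_fin sqr_ge0. Qed.

Lemma measurable_cond_mse s tau : 0 <= tau -> measurable_fun setT (cond_mse s tau).
Proof.
move=> tau0; apply: (@measurable_fun_fubini_tonelli_F _ _ _ _ _ (normal_prob 0 1)
  (fun z : R * R => ((soft_thresh (z.1 + s * z.2) tau - z.1) ^+ 2)%:E)).
  exact: measurable_se_error.
by move=> z; rewrite lee_fin sqr_ge0.
Qed.

Lemma measurable_se_error_snd s tau b : 0 <= tau ->
  measurable_fun setT (fun w : R => ((soft_thresh (b + s * w) tau - b) ^+ 2)%:E).
Proof.
move=> tau0.
exact: (measurableT_comp (measurable_se_error s tau tau0) (measurable_pair1 b)).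
Qed.

(** The bound is uniform in [b], so that it survives integration against [p] and makes [se_mse]
    finite. *)
Lemma cond_mse_ub s tau : 0 <= tau ->
  exists M : R, forall b, (cond_mse s tau b <= M%:E)%E.
Proof.
move=> tau0.
set I := (\int[@normal_prob R 0 1]_w (w ^+ 2)%:E)%E.
have I0 : (0 <= I)%E by apply: integral_ge0 => w _; rewrite lee_fin sqr_ge0.
have Ifin : I \is a fin_num by rewrite ge0_fin_numE// normal_prob_sqr_lty.
have msq : measurable_fun setT (fun w : R => (w ^+ 2)%:E).
  by apply/measurable_EFinP; exact: measurable_funX.
have s2 : 0 <= 2 * s ^+ 2 by rewrite mulr_ge0// sqr_ge0.
have t2 : 0 <= 2 * tau ^+ 2 by rewrite mulr_ge0// sqr_ge0.
exists (2 * s ^+ 2 * fine I + 2 * tau ^+ 2) => b.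
apply: (@le_trans _ _ (\int[normal_prob 0 1]_w
    ((2 * s ^+ 2)%:E * (w ^+ 2)%:E + (2 * tau ^+ 2)%:E))%E).
  apply: ge0_le_integral => //.
  - by move=> w _; rewrite lee_fin sqr_ge0.
  - exact: measurable_se_error_snd.
  - by apply: emeasurable_funD => //; exact: measurable_funeM.
  - by move=> w _; rewrite -EFinM -EFinD lee_fin se_error_ub.
rewrite ge0_integralD//; last 2 first.
- by move=> w _; rewrite -EFinM lee_fin mulr_ge0 ?sqr_ge0.
- exact: measurable_funeM.
rewrite ge0_integralZl//; last by move=> w _; rewrite lee_fin sqr_ge0.
have N1 : normal_prob (0 : R) 1 setT = 1%E by exact: probability_setT.
by rewrite integral_cst// [X in (_ + _ * X)%E]N1 mule1 EFinD (EFinM _ (fine I)) fineK.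
Qed.

Lemma cond_mse_fin_num s tau b : 0 <= tau -> cond_mse s tau b \is a fin_num.
Proof.
move=> tau0; have [M leM] := cond_mse_ub s tau tau0.
by rewrite ge0_fin_numE ?cond_mse_ge0// (le_lt_trans (leM b))// ltry.
Qed.

Lemma se_mse_ge0 (p : probability R R) s tau : (0 <= se_mse p s tau)%E.
Proof. by apply: integral_ge0 => b _; exact: cond_mse_ge0. Qed.

Lemma se_mse_lty (p : probability R R) s tau : 0 <= tau -> (se_mse p s tau < +oo)%E.
Proof.
move=> tau0; have [M leM] := cond_mse_ub s tau tau0.
apply: (@le_lt_trans _ _ (\int[p]_b M%:E)%E); last first.
  by rewrite integral_cst// [X in (_ * X)%E](@probability_setT _ _ _ p) mule1 ltry.
apply: ge0_le_integral => //.
- by move=> b _; exact: cond_mse_ge0.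
- exact: measurable_cond_mse.
- by move=> b _; exact: leM.
Qed.

Lemma cond_mse_lt alpha s s' b : 0 <= alpha -> 0 <= s' < s ->
  (cond_mse s' (alpha * s') b < cond_mse s (alpha * s) b)%E.
Proof.
move=> a0 /[dup] ss' /andP[s'0 s's].
have s0 : 0 <= s by exact/ltW/(le_lt_trans s'0).
pose e x w := ((soft_thresh (b + x * w) (alpha * x) - b) ^+ 2)%:E.
(* The ray is where the pointwise error grows strictly. *)
apply: (@lt_integral _ _ _ (normal_prob 0 1) `]alpha + `|b| / s, +oo[ (e s') (e s)).
- by apply: measurable_se_error_snd; exact: mulr_ge0.
- by apply: measurable_se_error_snd; exact: mulr_ge0.
- by move=> w; rewrite lee_fin sqr_ge0.
- by [].
- by move=> w; rewrite lee_fin se_error_le// s'0 ltW.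
- by rewrite -ge0_fin_numE ?cond_mse_ge0// cond_mse_fin_num// mulr_ge0.
- by [].
- exact: normal_prob_ray_gt0.
- by move=> w /=; rewrite in_itv/= andbT => hw; rewrite lte_fin se_error_lt.
Qed.

(** The conditional risk increases strictly at every [b], so the set of strict increase is the whole
    line, of mass 1. *)
Lemma se_mse_lt (p : probability R R) alpha s s' : 0 <= alpha -> 0 <= s' < s ->
  (se_mse p s' (alpha * s') < se_mse p s (alpha * s))%E.
Proof.
move=> a0 /[dup] ss' /andP[s'0 s's].
have s0 : 0 <= s by exact/ltW/(le_lt_trans s'0).
apply: (@lt_integral _ _ _ _ setT).
- by apply: measurable_cond_mse; exact: mulr_ge0.
- by apply: measurable_cond_mse; exact: mulr_ge0.
- by move=> b; exact: cond_mse_ge0.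
- by move=> b; apply: cond_mse_fin_num; exact: mulr_ge0.
- by move=> b; exact/ltW/cond_mse_lt.
- by apply: se_mse_lty; exact: mulr_ge0.
- by [].
- by rewrite [ltRHS](@probability_setT _ _ _ p) lte01.
- by move=> b _; exact: cond_mse_lt.
Qed.

End conditional_error.

(** * Propagation of a strict improvement along the state evolution *)

Section state_evolution.
Context {R : realType}.
Variables (p : probability R R) (delta sw2 : R).
Hypotheses (delta0 : 0 < delta) (sw20 : 0 <= sw2).
Local Notation sigma := (se_sigma p delta sw2).

(** For a nonnegative threshold the error is finite, so [fine] commutes with the sum and the
    product. *)
Lemma se_sigmaS tau t : 0 <= tau t ->
  sigma tau t.+1 = Num.sqrt (sw2 + delta^-1 * fine (se_mse p (sigma tau t) (tau t))).
Proof.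
move=> tau0; rewrite /se_sigma/= fineD ?fineM//.
- by rewrite ge0_fin_numE ?se_mse_ge0 ?se_mse_lty.
- by rewrite fin_numM// ge0_fin_numE ?se_mse_ge0 ?se_mse_lty.
Qed.

Lemma eq_se_sigma (tau tau' : nat -> R) t :
  (forall k, (k < t)%N -> tau k = tau' k) -> sigma tau t = sigma tau' t.
Proof.
rewrite /se_sigma; elim: t => [//|t IH] eq_tau /=.
by rewrite IH ?eq_tau// => k kt; rewrite eq_tau// ltnW.
Qed.

Lemma se_sigmaS_lt (tau tau' : nat -> R) t : 0 <= tau t -> sigma tau' t < sigma tau t ->
  tau' t = tau t / sigma tau t * sigma tau' t ->
  sigma tau' t.+1 < sigma tau t.+1.
Proof.
move=> tau0 lt_sigma tau'E.
have s'0 : 0 <= sigma tau' t by exact: sqrtr_ge0.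
have s0 : 0 < sigma tau t by exact: le_lt_trans lt_sigma.
have alpha0 : 0 <= tau t / sigma tau t by rewrite divr_ge0// ltW.
have tau'0 : 0 <= tau' t by rewrite tau'E mulr_ge0.
have := @se_mse_lt R p _ (sigma tau t) (sigma tau' t) alpha0.
rewrite s'0 lt_sigma divfK ?lt0r_neq0// -tau'E => /(_ isT) lt_mse.
have lt_fine : fine (se_mse p (sigma tau' t) (tau' t)) <
    fine (se_mse p (sigma tau t) (tau t)).
  by apply: fine_lt => //; rewrite ge0_fin_numE ?se_mse_ge0 ?se_mse_lty.
have lt_var : sw2 + delta^-1 * fine (se_mse p (sigma tau' t) (tau' t)) <
    sw2 + delta^-1 * fine (se_mse p (sigma tau t) (tau t)).
  by rewrite ltrD2l ltr_pM2l ?invr_gt0.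
(* Strict monotonicity of the square root asks that the larger variance be positive; it is above a
   nonnegative one. *)
rewrite !se_sigmaS// ltr_sqrt//; apply: le_lt_trans lt_var.
apply: addr_ge0; first exact: sw20.
by apply: mulr_ge0; [rewrite invr_ge0 ltW|exact/fine_ge0/se_mse_ge0].
Qed.

Lemma se_sigma_extend (tau tau' : nat -> R) t n :
  (forall k, (t <= k < t + n)%N -> 0 <= tau k) -> sigma tau' t < sigma tau t ->
  exists tau'' : nat -> R,
    [/\ forall k, (k < t)%N -> tau'' k = tau' k,
        forall k, (t <= k < t + n)%N -> 0 <= tau'' k &
        sigma tau'' (t + n) < sigma tau (t + n)].
Proof.
elim: n => [|n IH] tau0 lt_sigma.
  by exists tau'; split; rewrite ?addn0// => k /andP[tk kt]; rewrite ltnNge tk in kt.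
have [k /andP[tk kn]||tau2 [tau2E tau20 lt2]] := IH.
- by apply: tau0; rewrite tk addnS ltnW.
- exact: lt_sigma.
have tn0 : 0 <= tau (t + n)%N by apply: tau0; rewrite leq_addr addnS ltnSn.
(* The new threshold keeps the ratio of threshold to noise level that [tau] has at this step. *)
pose c := tau (t + n)%N / sigma tau (t + n) * sigma tau2 (t + n).
pose tau3 k := if k == (t + n)%N then c else tau2 k.
have eq_sigma : sigma tau3 (t + n) = sigma tau2 (t + n).
  by apply: eq_se_sigma => k kn; rewrite /tau3 ltn_eqF.
exists tau3; split.
- by move=> k kt; rewrite /tau3 ltn_eqF ?tau2E// ltn_addr.
- move=> k /andP[tk]; rewrite addnS ltnS leq_eqVlt /tau3 => /orP[->|kn].
    by rewrite mulr_ge0 ?divr_ge0// sqrtr_ge0.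
  by rewrite ltn_eqF// tau20// tk.
- by rewrite addnS; apply: se_sigmaS_lt; rewrite ?eq_sigma// /tau3 eqxx.
Qed.

End state_evolution.

(** * From optimality at [T] to optimality at earlier iterations *)

Theorem theorem6 (R : realType) (delta sw2 : R) (p : probability R R)
    (T : nat) (taus : nat -> R) :
  0 < delta < 1 -> 0 <= sw2 ->
  (\int[p]_b (b ^+ 2)%:E < +oo)%E ->
  (2 <= T)%N -> 0 <= taus 0%N ->
  asymp_optimal p delta sw2 T taus ->
  forall t : nat, (t < T)%N -> asymp_optimal p delta sw2 t taus.
Proof.
move=> /andP[delta0 _] sw20 _ _ _ [taus0 opt] t tT; split.
  by move=> k /andP[k1 kt]; apply: taus0; rewrite k1 (ltn_trans kt).
(* At iteration 0 both sides coincide. For a positive iteration the prefix retained from [tau]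
   contains index 0, so the extended sequence keeps the fixed initial threshold. *)
move=> tau tau_0 tau0; case: t => [//|t] in tT tau0 *.
rewrite leNgt; apply/negP => lt_sigma.
(* A better prefix [tau] is continued along [taus] for the remaining [T - t.+1] steps, giving a
   competitor that beats [taus] at [T]. *)
have [k /andP[tk kT]|tau2 [tau2E tau20]] :=
  se_sigma_extend _ _ _ delta0 sw20 _ _ _ (T - t.+1) _ lt_sigma.
  by apply: taus0; rewrite (leq_trans _ tk)//= -(subnKC (ltnW tT)).
rewrite subnKC ?(ltnW tT)// in tau20 *; apply/negP; rewrite -leNgt; apply: opt.
  by rewrite tau2E.
move=> k /andP[k1 kT]; have [kt|tk] := ltnP k t.+1; last by rewrite tau20// tk.
by rewrite tau2E// tau0// k1.
Qed.
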